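(* Let $H^\omega$, $\Lambda_L$, $H^\omega_{\Lambda_L}$ be as in the context, with $\alpha>0$, $\delta>1$ and $d-\alpha(\delta-1)>0$. For any open interval $(M_1,M_2)\supsetneq[-2d,2d]$ (i.e. $M_1<-2d$ and $M_2>2d$), $$\lim_{L\to\infty}\frac{1}{(2L+1)^d}\,\mathbb{E}\Big(\#\big\{\sigma(H^\omega_{\Lambda_L})\cap(M_1,M_2)\big\}\Big)=1,$$ where $\#\{\sigma(H^\omega_{\Lambda_L})\cap(M_1,M_2)\}$ is the number of eigenvalues of $H^\omega_{\Lambda_L}$ in $(M_1,M_2)$, counted with multiplicity.
   Context: Let $d\ge1$ be an integer. Let $\{q_n\}_{n\in\mathbb{Z}^d}$ be i.i.d. real random variables on a probability space $(\Omega,\mathcal{B},\mathbb{P})$ (expectation $\mathbb{E}$), whose common distribution $\mu$ has density $\rho(x)=0$ for $|x|<1$ and $\rho(x)=\frac{\delta-1}{2}|x|^{-\delta}$ for $|x|\ge1$, for some $\delta>1$. Let $\{a_n\}_{n\in\mathbb{Z}^d}$ be positive reals with $a_n\simeq|n|^{-\alpha}$, $\alpha>0$ (i.e. there are constants $0<c_1\le c_2$ with $c_1|n|^{-\alpha}\le a_n\le c_2|n|^{-\alpha}$ for all $n\ne0$; $|\cdot|$ is the Euclidean norm). Assume $d-\alpha(\delta-1)>0$. On $\ell^2(\mathbb{Z}^d)$, with standard basis $\{\delta_n\}$, let $(\Delta u)(n)=\sum_{|m-n|=1}u(m)$ and $H^\omega=-\Delta+V^\omega$, where $(V^\omega u)(n)=a_nq_n(\omega)u(n)$.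 For $L\in\mathbb{N}$ let $\Lambda_L=\{n\in\mathbb{Z}^d:|n_i|\le L,\ i=1,\dots,d\}$ and let $H^\omega_{\Lambda_L}$ be the finite symmetric matrix $(\langle\delta_n,H^\omega\delta_m\rangle)_{n,m\in\Lambda_L}$. *)

(* Defs.v *)
From HB Require Import structures.
From mathcomp Require Import all_boot all_order all_algebra finmap.
From mathcomp Require Import all_classical all_reals all_analysis.

Set Implicit Arguments.
Unset Strict Implicit.
Unset Printing Implicit Defensive.

Import Order.TTheory GRing.Theory Num.Theory.
Import numFieldNormedType.Exports.

Local Open Scope classical_set_scope.
Local Open Scope ring_scope.

(* The norm that MathComp-Analysis puts on matrices is the sup norm, hence a
   separate Euclidean norm on Z^d. *)
Definition enorm {R : realType} {d : nat} (n : 'rV[int]_d) : R :=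
  Num.sqrt (\sum_(i < d) (n ord0 i)%:~R ^+ 2).

Definition neighbours (R : realType) (d : nat) (n : 'rV[int]_d) :
    set 'rV[int]_d :=
  [set m | enorm (m - n) = 1 :> R].

Definition box (d L : nat) : set 'rV[int]_d :=
  [set n | forall i : 'I_d, `|n ord0 i| <= L%:Z].

Lemma finite_box d L : finite_set (@box d L).
Proof.
pose f (g : {ffun 'I_d -> 'I_(L + L).+1}) : 'rV[int]_d :=
  \row_i ((g i : nat)%:Z - L%:Z).
apply: (@sub_finite_set _ _ (f @` setT)); last exact/finite_image/finite_finset.
move=> n nL.
have nLi i : (absz (n ord0 i + L%:Z)%R < (L + L).+1)%N.
  have := nL i; rewrite ler_norml => /andP[l u].
  rewrite ltnS -lez_nat gez0_abs ?PoszD ?lerD2r//.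
  by rewrite -(addNr L%:Z) lerD2r.
exists [ffun i => Ordinal (nLi i)] => //; apply/rowP => i; rewrite !mxE ffunE /=.
have := nL i; rewrite ler_norml => /andP[l u].
by rewrite gez0_abs ?addrK// -(addNr L%:Z) lerD2r.
Qed.

Lemma finite_neighbours (R : realType) d (n : 'rV[int]_d) :
  finite_set (neighbours R n).
Proof.
apply: (@sub_finite_set _ _ ((fun m => m + n) @` @box d 1)); last first.
  exact/finite_image/finite_box.
move=> m nm; exists (m - n); last by rewrite subrK.
move=> i; have sq0 j : 0 <= ((m - n) ord0 j)%:~R ^+ 2 :> R by exact: sqr_ge0.
have s1 : \sum_(j < d) ((m - n) ord0 j)%:~R ^+ 2 = 1 :> R.
  by rewrite -[LHS]sqr_sqrtr ?sumr_ge0// (nm : Num.sqrt _ = 1) expr1n.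
have : ((m - n) ord0 i)%:~R ^+ 2 <= 1 :> R.
  by move: s1; rewrite (bigD1 i)//= => s1; rewrite -[leRHS]s1 lerDl sumr_ge0.
rewrite -real_normK ?num_real// expr_le1// -intr_norm.
by rewrite -[leRHS]/(1%:~R) ler_int.
Qed.

Section Operators.
Context {R : realType} {d : nat}.
Implicit Types (u v V : 'rV[int]_d -> R) (n m : 'rV[int]_d).

Definition laplacian u : 'rV[int]_d -> R :=
  fun n => \sum_(m \in neighbours R n) u m.

(* Formal action on arbitrary functions; the possibly unbounded operator on l^2
   is its restriction to a domain that contains the basis vectors. *)
Definition schrodinger V u : 'rV[int]_d -> R :=
  fun n => - laplacian u n + V n * u n.

Definition basis_vec n : 'rV[int]_d -> R := fun k => (k == n)%:R.

(* \sum_(k \in setT) is a sum over the support: this is the l^2 inner product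
   as soon as u or v has finite support, e.g. is a basis vector. *)
Definition inner u v : R := \sum_(k \in [set: 'rV[int]_d]) u k * v k.

(* Rows and columns are numbered along some enumeration of the finite box. *)
Definition box_matrix (H : ('rV[int]_d -> R) -> 'rV[int]_d -> R) (L : nat) :
    'M[R]_(#|` fset_set (@box d L)|) :=
  let site := nth 0 (enum_fset (fset_set (@box d L))) in
  \matrix_(i, j) inner (basis_vec (site i)) (H (basis_vec (site j))).

End Operators.

(* Number of eigenvalues in I; an eigenvalue x is counted dim ker (A - x)
   times. *)
Definition eigenvalue_count {R : realType} {k : nat} (A : 'M[R]_k)
    (I : set R) : nat :=
  \big[addn/0%N]_(x \in [set x | eigenvalue A x] `&` I) \rank (eigenspace A x).

Definition pareto_density {R : realType} (delta x : R) : R :=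
  if `|x| < 1 then 0 else (delta - 1) / 2 * `|x| `^ (- delta).

Definition mutually_independent {dT : measure_display} {T : measurableType dT}
    {R : realType} (P : probability T R) {I : choiceType}
    (X : I -> {RV P >-> R}) : Prop :=
  forall (F : {fset I}) (B : I -> set R), (forall i, measurable (B i)) ->
    P (\bigcap_(i in [set` F]) (X i @^-1` B i)) =
    (\prod_(i <- F) P (X i @^-1` B i))%E.

Definition has_density {dT : measure_display} {T : measurableType dT}
    {R : realType} (P : probability T R) (X : {RV P >-> R}) (rho : R -> R) :
    Prop :=
  forall B : set R, measurable B ->
    distribution P X B = (\int[lebesgue_measure]_(x in B) (rho x)%:E)%E.

Definition comparable_to_power {R : realType} {d : nat}
    (a : 'rV[int]_d -> R) (alpha : R) : Prop :=
  exists c1 c2 : R, [/\ 0 < c1, c1 <= c2 &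
    forall n, n != 0 ->
      c1 * enorm n `^ (- alpha) <= a n <= c2 * enorm n `^ (- alpha)].

(* Main.v *)
(** Put eps := min (M2 - 2d) (- 2d - M1) and call a site n good when
    |a_n q_n| < eps.  On vectors supported on the good sites of the box,
    ||H u|| < (2d + eps) ||u||, because the adjacency operator has norm at most
    2d; on the sum of the eigenspaces for eigenvalues of modulus at least
    2d + eps the reverse inequality holds.  These two subspaces meet trivially,
    so at least as many eigenvalues lie in (M1, M2) as there are good sites.
    Since a_n tends to 0 and the q_n share one law, the probability that n is
    good tends to 1, and averaging over the box gives the limit. *)

Require Import Defs.
From HB Require Import structures.
From mathcomp Require Import all_boot all_order all_algebra finmap.
From mathcomp Require Import complex.
From mathcomp Require Import all_classical all_reals all_analysis.
From mathcomp Require Import measurable_realfun.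
From mathcomp Require Import zify ring lra.

Set Implicit Arguments.
Unset Strict Implicit.
Unset Printing Implicit Defensive.

Import Order.TTheory GRing.Theory Num.Theory.
Import numFieldNormedType.Exports.

Local Open Scope classical_set_scope.
Local Open Scope ring_scope.

(** * Eigenspaces of real symmetric matrices and eigenvalue counts *)

(** Over the complex numbers the matrix is Hermitian, so by the spectral theorem its minimal
    polynomial is a product of distinct factors ['X - r%:P] with [r] real. Divisibility descends to
    [R], where it amounts to diagonalizability. *)
Lemma symmetric_eigenspaces_sum (R : realType) n (A : 'M[R]_n) : A^T = A ->
  exists2 rs, uniq rs & (\sum_(r <- rs) eigenspace A r :=: 1%:M)%MS.
Proof.
case: n A => [|n] A symA.
  by exists [::] => //; rewrite [1%:M]flatmx0 big_nil; exact: eqmx_refl.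
apply/diagonalizablePeigen/diagonalizableP.
pose AC := map_mx (real_complex R) A.
have hermA : AC \is hermsymmx.
  apply/realsym_hermsym; last first.
    by apply/mxOverP => i j; rewrite mxE complex_real.
  apply/is_hermitianmxP; rewrite expr0 scale1r map_mx_id//.
  by rewrite map_trmx symA.
have dreal i : (spectral_diag AC 0 i) = real_complex R (complex.Re (spectral_diag AC 0 i)).
  by rewrite RRe_real//; exact: (mxOverP (hermitian_spectral_diag_real hermA)).
set s := [seq complex.Re (spectral_diag AC 0 i) | i <- enum 'I_n.+1].
exists (undup s); first exact: undup_uniq.
rewrite -(dvdp_map (real_complex R)) -mxminpoly_map -/AC.
have /orthomx_spectralP -> := hermitian_normalmx hermA.
rewrite -conjVmx ?spectral_unit// mxminpoly_uconj ?unitmx_inv ?spectral_unit//.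
rewrite mxminpoly_diag rmorph_prod.
have -> : [seq spectral_diag AC 0 i | i <- enum 'I_n.+1] =
    map (real_complex R) s.
  by rewrite /s -[RHS]map_comp; apply: eq_map => i; exact: dreal.
rewrite undup_map_inj; last exact: complexI.
by rewrite big_map; under [X in _ %| X]eq_bigr do
  rewrite rmorphB /= map_polyX map_polyC.
Qed.

Lemma rank_sum_eigenspace (F : fieldType) n (A : 'M[F]_n) (rs : seq F) (p : pred F) :
  uniq rs -> \rank (\sum_(r <- rs | p r) eigenspace A r)%MS =
  (\sum_(r <- rs | p r) \rank (eigenspace A r))%N.
Proof.
move=> urs; rewrite [X in \rank X](big_nth 0) [X in \rank X]big_mkord.
rewrite [RHS](big_nth 0) [RHS]big_mkord.
have dx : mxdirect (\sum_(i < size rs | p rs`_i) eigenspace A rs`_i)%MS.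
  apply: mxdirect_sum_eigenspace => i j _ _ /eqP.
  by rewrite nth_uniq// => /eqP/val_inj.
exact: (mxdirectP dx).
Qed.

Lemma leq_sum_rank_eigenspace (F : fieldType) n (A : 'M[F]_n) (rs : seq F) :
  uniq rs -> (\sum_(r <- rs) \rank (eigenspace A r) <= n)%N.
Proof. by move=> urs; rewrite -rank_sum_eigenspace// rank_leq_row. Qed.

(* [finite_support] is empty when the support is infinite, so finiteness of the
   spectrum plays no role here. *)
Lemma eigenvalue_count_leq (R : realType) k (A : 'M[R]_k) (I : set R) :
  (eigenvalue_count A I <= k)%N.
Proof. exact/leq_sum_rank_eigenspace/finite_support_uniq. Qed.

(** Replaces the sum over a set of eigenvalues by a sum over one fixed list. The ranks along [rs]
    already add up to [k], so no eigenvalue lies outside [rs]; members of [rs] that are not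
    eigenvalues contribute rank 0. *)
Lemma eigenvalue_count_seq (R : realType) k (A : 'M[R]_k) (rs : seq R)
    (I : set R) : uniq rs -> (\sum_(r <- rs) eigenspace A r :=: 1%:M)%MS ->
  eigenvalue_count A I = (\sum_(r <- rs | r \in I) \rank (eigenspace A r))%N.
Proof.
move=> urs rs1.
have rkrs : (\sum_(r <- rs) \rank (eigenspace A r) = k)%N.
  by rewrite -(@rank_sum_eigenspace _ _ _ _ xpredT)// rs1 mxrank1.
have rk0 x : x \notin rs -> \rank (eigenspace A x) = 0%N.
  (* The ranks along [x :: rs] also total at most [k], which leaves 0 for [x]. *)
  move=> xrs; have := @leq_sum_rank_eigenspace _ _ A (x :: rs).
  rewrite /= xrs urs big_cons rkrs => /(_ isT).
  by rewrite -[leqRHS]add0n leq_add2r leqn0 => /eqP.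
pose E := [set x | eigenvalue A x] `&` I.
rewrite /eigenvalue_count (@fsbigE _ _ _ _ _ [seq x <- rs | x \in E])//; last 3 first.
- exact: filter_uniq.
- by move=> x; rewrite /= mem_filter => /andP[/set_mem].
- by move=> x /mem_set xE; rewrite mem_filter xE /= => /rk0.
rewrite big_filter_cond /= [RHS](bigID (fun x => x \in E))/=.
rewrite [X in (_ + X)%N]big1 ?addn0; last first.
  move=> x /andP[/set_mem xI]; apply: contraNeq; rewrite mxrank_eq0 => xA.
  exact/mem_set.
by apply: eq_bigl => x; rewrite /E in_setI; do 2 case: (x \in _).
Qed.

Lemma eigenvalue_countS (R : realType) k (A : 'M[R]_k) (I J : set R) :
  A^T = A -> I `<=` J -> (eigenvalue_count A I <= eigenvalue_count A J)%N.
Proof.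
move=> symA IJ; have [rs urs rs1] := symmetric_eigenspaces_sum symA.
rewrite !(eigenvalue_count_seq _ urs rs1) [leqRHS](bigID (fun x => x \in I))/=.
apply: leq_trans (leq_addr _ _); rewrite leq_eqVlt; apply/orP; left; apply/eqP.
apply: eq_bigl => x; have [/set_mem/IJ/mem_set -> //|] := boolP (x \in I).
by rewrite andbF.
Qed.

(** * Squared Euclidean norms, the dimension count and the Schur test *)

Definition sqnorm (R : realType) n (u : 'rV[R]_n) : R := \sum_i u 0 i ^+ 2.

Lemma sqnormE (R : realType) n (u : 'rV[R]_n) : sqnorm u = (u *m u^T) 0 0.
Proof. by rewrite mxE; apply: eq_bigr => i _; rewrite mxE expr2. Qed.

Lemma sqnorm_ge0 (R : realType) n (u : 'rV[R]_n) : 0 <= sqnorm u.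
Proof. by apply: sumr_ge0 => i _; exact: sqr_ge0. Qed.

(** Pythagoras: the cross terms [v i *m (v j)^T] vanish. *)
Lemma sqnorm_sum (R : realType) n (I : finType) (p : pred I) (v : I -> 'rV[R]_n) :
  (forall i j, i != j -> v i *m (v j)^T = 0) ->
  sqnorm (\sum_(i | p i) v i) = \sum_(i | p i) sqnorm (v i).
Proof.
move=> vv; rewrite sqnormE mulmx_suml summxE; apply: eq_bigr => i pi.
rewrite raddf_sum mulmx_sumr (bigD1 i)//= big1 ?addr0 -?sqnormE//.
by move=> j /andP[_ ji]; rewrite vv// eq_sym.
Qed.

(** By symmetry [u *m A *m v^T] is both [x] times and [y] times [u *m v^T]. *)
Lemma eigenvectors_orthogonal (R : realType) n (A : 'M[R]_n) (x y : R)
    (u v : 'rV[R]_n) : A^T = A -> u *m A = x *: u -> v *m A = y *: v -> x != y ->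
  u *m v^T = 0.
Proof.
move=> symA uA vA xy.
have : u *m A *m v^T = u *m (v *m A)^T by rewrite trmx_mul symA mulmxA.
rewrite uA vA linearZ/= -scalemxAl -scalemxAr => /eqP.
by rewrite -subr_eq0 -scalerBl scaler_eq0 subr_eq0 (negPf xy) => /eqP.
Qed.

(** The eigencomponents of [v] are orthogonal and [A] stretches each by a factor of modulus at least
    [M]; Pythagoras applies to [v] and to [v *m A]. *)
Lemma sqnorm_eigenspaces (R : realType) n (A : 'M[R]_n) (rs : seq R) (M : R)
    (p : pred R) (v : 'rV[R]_n) :
  A^T = A -> uniq rs -> 0 <= M -> (forall x, p x -> M <= `|x|) ->
  (v <= \sum_(r <- rs | p r) eigenspace A r)%MS ->
  M ^+ 2 * sqnorm v <= sqnorm (v *m A).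
Proof.
move=> symA urs M0 pM; rewrite (big_nth 0) big_mkord => /sub_sumsmxP[u ->].
set w := fun i : 'I_(size rs) => u i *m eigenspace A rs`_i.
have wA i : w i *m A = rs`_i *: w i.
  by apply/eigenspaceP; rewrite submxMl.
have ww i j : i != j -> w i *m (w j)^T = 0.
  move=> ij; apply: (eigenvectors_orthogonal symA (wA i) (wA j)).
  by rewrite nth_uniq.
rewrite mulmx_suml -/w; under [in leRHS]eq_bigr do rewrite wA.
rewrite !sqnorm_sum// ?mulr_sumr; last first.
  by move=> i j ij; rewrite linearZ/= -scalemxAl -scalemxAr ww// !scaler0.
apply: ler_sum => i pi.
have -> : sqnorm (rs`_i *: w i) = rs`_i ^+ 2 * sqnorm (w i).
  by rewrite mulr_sumr; apply: eq_bigr => j _; rewrite mxE exprMn.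
by rewrite ler_wpM2r ?sqnorm_ge0// -[leRHS]real_normK ?num_real// lerXn2r ?nnegrE// pM.
Qed.

(** The ranks of all eigenspaces total [n]. The coordinate space of [S] is independent of the sum
    [E] of the eigenspaces outside the interval, so its dimension is at most what [E] leaves over,
    namely the count inside. *)
Lemma leq_card_eigenvalue_count (R : realType) n (A : 'M[R]_n) (S : {set 'I_n})
    (M : R) : A^T = A -> 0 <= M ->
  (forall u : 'rV[R]_n, u != 0 -> (forall i, i \notin S -> u 0 i = 0) ->
    sqnorm (u *m A) < M ^+ 2 * sqnorm u) ->
  (#|S| <= eigenvalue_count A `]-M, M[%classic)%N.
Proof.
move=> symA M0 small; have [rs urs rs1] := symmetric_eigenspaces_sum symA.
rewrite (eigenvalue_count_seq _ urs rs1).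
set I := `]-M, M[%classic.
pose E := (\sum_(r <- rs | r \notin I) eigenspace A r)%MS.
(* The rows are the unit vectors indexed by [S], so [W *m W^T] is the identity and [W] has full
   rank. *)
pose W : 'M[R]_(#|S|, n) := rowsub (@enum_val _ (mem S)) 1%:M.
have rkW : \rank W = #|S|.
  apply/eqP/row_freeP; exists W^T; apply/matrixP => i j.
  rewrite !mxE (bigD1 (enum_val i))//= big1 ?addr0; last first.
    by move=> k ki; rewrite !mxE eq_sym (negPf ki) mul0r.
  by rewrite !mxE eqxx mul1r (inj_eq enum_val_inj) eq_sym.
have WE : (W :&: E)%MS = 0.
  apply/eqP/rowV0P => v; rewrite sub_capmx => /andP[/submxP[u uW] vE].
  apply/eqP; apply: contraT => v0.
  (* Since [v] lies in [E], the conclusion of [small] is false; a contradiction follows once [v] is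
     seen to vanish off [S]. *)
  have := small v v0; rewrite ltNge (@sqnorm_eigenspaces _ _ _ rs _ [pred x | x \notin I])//.
    move=> H; exfalso; suff : false by []; apply: H => i iS; rewrite uW mxE big1// => j _.
    rewrite !mxE; case: eqP => [ji|]; last by rewrite mulr0.
    by move: iS; rewrite -ji enum_valP.
  move=> x /=; rewrite /I notin_setE/= in_itv/= -ltr_norml => /negP.
  by rewrite leNgt.
have rkrs : (\sum_(r <- rs) \rank (eigenspace A r) = n)%N.
  by rewrite -(@rank_sum_eigenspace _ _ _ _ xpredT)// rs1 mxrank1.
have : (\rank (W + E)%MS <= \sum_(r <- rs) \rank (eigenspace A r))%N.
  by rewrite rkrs rank_leq_row.
rewrite mxrank_disjoint_sum// rkW rank_sum_eigenspace//.
by rewrite [leqRHS](bigID (fun x => x \in I))/= leq_add2r.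
Qed.

(** Schur test, by Cauchy-Schwarz and one exchange of sums. With [a] the adjacency matrix of the box
    it yields the norm bound 2d. *)
Lemma sqnorm_schur (R : realType) n (a : 'I_n -> 'I_n -> R) (D : R) (u : 'rV[R]_n) :
  (forall i j, 0 <= a i j) -> (forall i j, a i j = a j i) ->
  (forall i, \sum_j a i j <= D) ->
  \sum_j (\sum_i u 0 i * a i j) ^+ 2 <= D ^+ 2 * sqnorm u.
Proof.
move=> a0 aC aD.
(* [D >= 0] is read off from row 0, which exists only in positive size; in size 0 both sides
   vanish. *)
case: n a u a0 aC aD => [|n] a u a0 aC aD; first by rewrite /sqnorm !big_ord0 mulr0.
have D0 : 0 <= D by apply: le_trans (aD 0); exact: sumr_ge0.
(* Cauchy-Schwarz with weights [a i j]. *)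
have step j : (\sum_i u 0 i * a i j) ^+ 2 <= D * \sum_i u 0 i ^+ 2 * a i j.
  apply: (@le_trans _ _ ((\sum_k a k j) * \sum_i u 0 i ^+ 2 * a i j)); last first.
    rewrite ler_wpM2r ?sumr_ge0// => [i _|]; first by rewrite mulr_ge0 ?sqr_ge0.
    by under eq_bigr do rewrite aC.
  rewrite expr2 !mulr_suml -subr_ge0.
  set X := \sum_(i < n.+1) _ * _; set Y := \sum_(i < n.+1) _ * _.
  (* Lagrange's identity writes the Cauchy-Schwarz defect as a weighted sum of squares. *)
  suff -> : X - Y = 2^-1 * \sum_i \sum_k (u 0 i - u 0 k) ^+ 2 * (a i j * a k j).
    rewrite mulr_ge0// sumr_ge0// => i _; rewrite sumr_ge0// => k _.
    by rewrite mulr_ge0 ?sqr_ge0 ?mulr_ge0.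
  have XE : X = \sum_i \sum_k u 0 i ^+ 2 * (a i j * a k j).
    rewrite /X exchange_big/=; under eq_bigr do rewrite mulr_sumr.
    by apply: eq_bigr => i _; apply: eq_bigr => k _; ring.
  have X'E : X = \sum_i \sum_k u 0 k ^+ 2 * (a i j * a k j).
    rewrite XE exchange_big/=.
    by apply: eq_bigr => i _; apply: eq_bigr => k _; ring.
  have YE : Y = \sum_i \sum_k u 0 i * u 0 k * (a i j * a k j).
    rewrite /Y; under eq_bigr do rewrite mulr_sumr.
    by apply: eq_bigr => i _; apply: eq_bigr => k _; ring.
  have -> : X - Y = 2^-1 * (X + X - 2 * Y) by field.
  congr (_ * _); rewrite {1}XE X'E YE mulr_sumr -big_split -sumrB/=.
  apply: eq_bigr => i _; rewrite mulr_sumr -big_split -sumrB/=.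
  by apply: eq_bigr => k _; ring.
apply: le_trans (ler_sum _ (fun j _ => step j)) _.
(* Summing over [j] first, the row sums of [a] give the second factor [D]. *)
rewrite -mulr_sumr expr2 -mulrA ler_wpM2l// exchange_big/= mulr_sumr.
apply: ler_sum => i _; rewrite -mulr_sumr mulrC ler_wpM2r ?sqr_ge0//.
Qed.

(** * Neighbours and boxes in the lattice *)

Lemma enorm_sqr (R : realType) d (n : 'rV[int]_d) :
  enorm n ^+ 2 = \sum_i (n 0 i)%:~R ^+ 2 :> R.
Proof. by rewrite sqr_sqrtr// sumr_ge0// => i _; rewrite sqr_ge0. Qed.

Lemma enormN (R : realType) d (n : 'rV[int]_d) : enorm (- n) = enorm n :> R.
Proof.
by congr Num.sqrt; apply: eq_bigr => i _; rewrite mxE rmorphN/= sqrrN.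
Qed.

(** When integer squares add up to 1, one of them is 1 and the others are 0. *)
Lemma enorm1P (R : realType) d (n : 'rV[int]_d) : enorm n = 1 :> R ->
  exists i (b : bool), n = (-1) ^+ b *: delta_mx 0 i.
Proof.
move=> n1; have /eqP := @enorm_sqr R d n.
rewrite n1 expr1n; under eq_bigr do rewrite -rmorphXn/=.
rewrite -rmorph_sum/= -[1]/(1%:~R) eqr_int => /eqP sum1.
have /existsP[i ni] : [exists i, n 0 i != 0].
  rewrite -negb_forall; apply/negP => /forallP n0; move: sum1.
  by rewrite big1// => i _; rewrite (eqP (n0 i)) expr0n.
have [ni1 nj0] : n 0 i ^+ 2 = 1 /\ forall j, j != i -> n 0 j = 0.
  have ge1 : 1 <= n 0 i ^+ 2 by rewrite -gtz0_ge1 lt0r sqrf_eq0 ni sqr_ge0.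
  have ge0 : 0 <= \sum_(j | j != i) n 0 j ^+ 2.
    by apply: sumr_ge0 => j _; exact: sqr_ge0.
  move: sum1; rewrite (bigD1 i)//= => sum1.
  have s0 : \sum_(j | j != i) n 0 j ^+ 2 = 0.
    by apply/eqP; rewrite eq_le ge0 andbT -(lerD2l (n 0 i ^+ 2)) -sum1 addr0.
  split; first by rewrite [RHS]sum1 s0 addr0.
  move/eqP : s0; rewrite psumr_eq0; last by move=> j _; exact: sqr_ge0.
  move=> /allP s0 j ji; have := s0 j (mem_index_enum j).
  by rewrite ji/= sqrf_eq0 => /eqP.
have [b nib] : exists b : bool, n 0 i = (-1) ^+ b.
  move/eqP : ni1; rewrite sqrf_eq1 => /orP[]/eqP ->.
    by exists false.
  by exists true.
exists i, b; apply/rowP => j; rewrite !mxE eqxx/=.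
by have [->|/nj0 ->] := eqVneq j i; rewrite ?mulr1 ?mulr0.
Qed.

(** Every neighbour of [n] occurs in the list [nb] of the 2d sites obtained by adding a signed unit
    vector to [n]. *)
Lemma count_neighbours (R : realType) d (n : 'rV[int]_d) (s : seq 'rV[int]_d) :
  uniq s -> (count (fun m => enorm (m - n)%R == 1 :> R)%R s <= 2 * d)%N.
Proof.
move=> us; pose nb := [seq n + (-1) ^+ (ib.2 : bool) *: delta_mx 0 ib.1 |
  ib <- enum {: 'I_d * bool}].
have -> : (2 * d)%N = size nb.
  by rewrite size_map -cardT card_prod card_ord card_bool mulnC.
rewrite -size_filter; apply: uniq_leq_size; first exact: filter_uniq.
move=> m; rewrite mem_filter => /andP[/eqP/enorm1P[i [b mnE]] _].
by apply/mapP; exists (i, b); rewrite ?mem_enum//= -mnE addrC subrK.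
Qed.

(** Shifting coordinates by [L] identifies the box with the functions from ['I_d] to
    ['I_(2 * L + 1)]. *)
Lemma card_box d L : #|` fset_set (@box d L)| = ((2 * L + 1) ^ d)%N.
Proof.
pose f (g : {ffun 'I_d -> 'I_(2 * L + 1)}) : 'rV[int]_d :=
  \row_i ((g i : nat)%:Z - L%:Z).
have finj : injective f.
  move=> g h /rowP gh; apply/ffunP => i; apply/val_inj.
  by have := gh i; rewrite !mxE => /addIr[].
have -> : ((2 * L + 1) ^ d)%N = size (map f (enum {ffun 'I_d -> 'I_(2 * L + 1)})).
  by rewrite size_map -cardT card_ffun !card_ord.
apply/perm_size/uniq_perm; first exact: fset_uniq.
  by rewrite map_inj_uniq ?enum_uniq.
move=> n; rewrite in_fset_set; last exact: finite_box.
apply/idP/mapP => [/set_mem nL|[g _ ->]]; last first.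
  apply/mem_set => i; rewrite mxE; case: (g i) => k /= kL.
  by rewrite ler_norml; apply/andP; split; lia.
have nLi i : - L%:Z <= n 0 i <= L%:Z by rewrite -ler_norml; exact: nL.
have gP i : (`|(n 0 i + L%:Z)%R|%N < 2 * L + 1)%N by have := nLi i; lia.
exists [ffun i => Ordinal (gP i)]; first by rewrite mem_enum.
apply/rowP => i; rewrite !mxE ffunE/= gez0_abs ?addrK//.
by have /andP[+ _] := nLi i; rewrite -subr_ge0 opprK.
Qed.

(** * Entries of the box matrix and the deterministic eigenvalue bound *)

Lemma laplacian_basis_vec (R : realType) d (n m : 'rV[int]_d) :
  laplacian (basis_vec m) n = (enorm (m - n) == 1 :> R)%:R :> R.
Proof.
(* Only [m] can contribute, so the sum runs over [[:: m]] or over the empty list. *)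
pose r := [seq k <- [:: m] | enorm (k - n) == 1 :> R].
rewrite /laplacian (@fsbigE _ _ _ _ _ r).
- rewrite big_filter_cond big_mkcond big_seq1 /basis_vec eqxx.
  case: ifPn => [/andP[->]//|]; rewrite negb_and => /orP[/negPf -> //|].
  by rewrite notin_setE /neighbours/=; case: eqP.
- exact: filter_uniq.
- by move=> k /=; rewrite mem_filter => /andP[/eqP].
- move=> k nk; rewrite mem_filter (_ : enorm _ == 1)/=; last exact/eqP.
  by rewrite inE /basis_vec eq_sym => /negPf ->.
Qed.

Lemma inner_basis_vec (R : realType) d (n : 'rV[int]_d) (u : 'rV[int]_d -> R) :
  inner (basis_vec n) u = u n.
Proof.
rewrite /inner (@fsbigE _ _ _ _ _ [:: n])//.
  by rewrite big_mkcond big_seq1 in_setT /basis_vec eqxx mul1r.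
by move=> k _; rewrite inE /basis_vec => /negPf ->; rewrite mul0r.
Qed.

Lemma box_matrixE (R : realType) d (V : 'rV[int]_d -> R) L i j :
  let site := nth 0 (enum_fset (fset_set (@box d L))) in
  box_matrix (schrodinger V) L i j =
  - (enorm (site i - site j) == 1 :> R)%:R + V (site j) * (i == j)%:R.
Proof.
move=> site; rewrite mxE inner_basis_vec /schrodinger laplacian_basis_vec -/site.
rewrite -enormN opprB; congr (_ + _); rewrite /basis_vec nth_uniq ?fset_uniq//.
by rewrite (inj_eq val_inj); case: eqP => [->|] //; rewrite !mulr0.
Qed.

Lemma trmx_box_matrix (R : realType) d (V : 'rV[int]_d -> R) L :
  (box_matrix (schrodinger V) L)^T = box_matrix (schrodinger V) L.
Proof.
apply/matrixP => i j; rewrite mxE !box_matrixE -enormN opprB [j == i]eq_sym.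
by have [->|_] := eqVneq i j; rewrite // !mulr0.
Qed.

(** The deterministic core, for a fixed potential. For vectors supported on the sites where
    [|V n| < eps], the Schur test bounds the adjacency part by 2d and the potential part is strictly
    below [eps]. *)
Lemma count_small_potential (R : realType) d (V : 'rV[int]_d -> R) L (eps : R) :
  (0 < d)%N -> 0 < eps ->
  (count (fun n => `|V n| < eps)%R (fset_set (@box d L)) <=
   eigenvalue_count (box_matrix (schrodinger V) L)
     `](- (2 * d%:R + eps)%R), (2 * d%:R + eps)%R[%classic)%N.
Proof.
move=> d0 e0; set s := enum_fset (fset_set (@box d L)).
pose site := nth 0 s; pose N := size s.
have us : uniq s by exact: fset_uniq.
set A := box_matrix _ _.
pose a i j : R := (enorm (site i - site j) == 1 :> R)%:R.
have aC i j : a i j = a j i by rewrite /a -enormN opprB.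
pose D : R := 2 * d%:R; have D0 : 0 < D by rewrite mulr_gt0 ?ltr0n.
have aD (i : 'I_N) : \sum_(j < N) a i j <= D.
  under eq_bigr do rewrite aC.
  rewrite /a -natr_sum /D -natrM ler_nat.
  have := count_neighbours R (site i) us; apply: leq_trans.
  by rewrite -sum1_count [leqRHS]big_mkcond (big_nth 0) big_mkord.
pose S : {set 'I_N} := [set i : 'I_N | `|V (site i)| < eps]%SET.
have -> : count (fun n => `|V n| < eps) s = #|S|.
  rewrite -sum1_count -sum1_card (big_nth 0) big_mkord.
  by apply: eq_bigl => i; rewrite inE.
apply: leq_card_eigenvalue_count.
- exact: trmx_box_matrix.
- by rewrite addr_ge0// ltW.
move=> u u0 uS; rewrite -/D.
have uA (j : 'I_N) : (u *m A) 0 j = V (site j) * u 0 j - \sum_(i < N) u 0 i * a i j.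
  rewrite mxE; under eq_bigr do rewrite box_matrixE -/s -/site mulrDr mulrN.
  rewrite big_split/= addrC sumrN; congr (_ - _).
  rewrite (bigD1 j)//= big1 ?addr0; first by rewrite eqxx mulr1 mulrC.
  by move=> i /negPf ->; rewrite !mulr0.
have VS : \sum_(j < N) (V (site j) * u 0 j) ^+ 2 < eps ^+ 2 * sqnorm u.
  have le1 (j : 'I_N) : (V (site j) * u 0 j) ^+ 2 <= eps ^+ 2 * u 0 j ^+ 2.
    rewrite exprMn; have [->|uj] := eqVneq (u 0 j) 0; first by rewrite expr0n !mulr0.
    have : j \in S by apply: contraNT uj => /uS ->.
    rewrite inE => Vj; rewrite ler_wpM2r ?sqr_ge0// -real_normK ?num_real//.
    by rewrite lerXn2r ?nnegrE// ltW.
  (* Strictness comes from one nonzero coordinate, which must lie in [S]. *)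
  have [j uj] : exists j : 'I_N, u 0 j != 0.
    by apply/rV0Pn.
  have jS : j \in S by apply: contraNT uj => /uS ->.
  rewrite /sqnorm mulr_sumr (bigD1 j)//= [ltRHS](bigD1 j)//=.
  apply: ltr_leD; last exact: ler_sum.
  rewrite exprMn ltr_pM2r; last by rewrite lt0r sqrf_eq0 uj sqr_ge0.
  move: jS; rewrite inE => Vj; rewrite -real_normK ?num_real//.
  by rewrite ltrXn2r ?nnegrE// ltW.
have DS := @sqnorm_schur _ N a D u (fun i j => ler0n _ _) aC aD.
(* Weighted convexity: (y - x)^2 / (D + eps) <= x^2 / D + y^2 / eps. *)
have AD : D * eps * sqnorm (u *m A) <= (D + eps) *
    (eps * (\sum_(j < N) (\sum_(i < N) u 0 i * a i j) ^+ 2) +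
     D * \sum_(j < N) (V (site j) * u 0 j) ^+ 2).
  rewrite !mulr_sumr -big_split mulr_sumr; apply: ler_sum => j _ /=.
  rewrite uA; set x := \sum_i _; set y := V _ * _; rewrite -subr_ge0.
  suff -> : (D + eps) * (eps * x ^+ 2 + D * y ^+ 2) - D * eps * (y - x) ^+ 2
    = (eps * x + D * y) ^+ 2 by exact: sqr_ge0.
  by ring.
rewrite -(ltr_pM2l (mulr_gt0 D0 e0)); apply: le_lt_trans AD _.
(* With [DS] and [VS] inserted, the right side becomes exactly
   [D * eps * (D + eps) ^+ 2 * sqnorm u]. *)
apply: (@lt_le_trans _ _ ((D + eps) * (eps * (D ^+ 2 * sqnorm u) + D * (eps ^+ 2 * sqnorm u)))).
  rewrite ltr_pM2l ?addr_gt0//; apply: ler_ltD.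
    by rewrite ler_pM2l.
  by rewrite ltr_pM2l.
by rewrite le_eqVlt; apply/orP; left; apply/eqP; ring.
Qed.

(** * Integrals and tightness of a law *)

Local Open Scope ereal_scope.

(* The integral of a nonnegative function is the supremum over the simple
   functions below it, whether or not the function is measurable; this spares us
   the measurability of the eigenvalue count. *)
Lemma le_integral_nonmeasurable d (T : measurableType d) (R : realType)
    (mu : {measure set T -> \bar R}) (f g : T -> \bar R) :
  (forall x, 0 <= f x) -> (forall x, f x <= g x) ->
  \int[mu]_x f x <= \int[mu]_x g x.
Proof.
move=> f0 fg; rewrite !ge0_integralTE//; last first.
  by move=> x; exact: le_trans (fg x).
by apply: ereal_sup_le => _ [h hf <-]; exists h => // x; exact: le_trans (fg x).
Qed.

(** Continuity from below: the balls of integer radius exhaust the line. *)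
Lemma distribution_ball_near1 d (T : measurableType d) (R : realType)
    (P : probability T R) (X : {RV P >-> R}) (eta : R) : (0 < eta)%R ->
  exists2 t : R, (0 < t)%R &
    (1 - eta)%:E <= distribution P X [set x | `|x| < t]%R.
Proof.
move=> eta0; pose F n : set R := [set x | `|x| < n%:R]%R.
have mF n : measurable (F n).
  rewrite (_ : F n = `](- n%:R)%R, n%:R[%classic)//.
  by apply/seteqP; split => x; rewrite /F/= in_itv/= ltr_norml.
have FT : \bigcup_n F n = setT.
  apply/seteqP; split => // x _; exists (Num.bound `|x|%R) => //=.
  by rewrite /F/= archi_boundP.
have : distribution P X (F n) @[n --> \oo] --> distribution P X (\bigcup_n F n).
  apply: nondecreasing_cvg_mu => //; first by rewrite FT.
  move=> m n mn; apply/subsetPset => x; rewrite /F/= => /lt_le_trans; apply.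
  by rewrite ler_nat.
(* The index [n.+1] keeps the radius positive. *)
rewrite FT probability_setT => /fine_cvgP[_] /cvgrPdist_le/(_ _ eta0)[n _ /(_ n.+1)].
rewrite /= leqnSn => /(_ isT) h; exists n.+1%:R => //.
rewrite -(fineK (fin_num_measure _ _ (mF n.+1))) lee_fin.
by move: h; rewrite ler_norml; lra.
Qed.

Local Close Scope ereal_scope.

(** * Decay of the coefficients *)

Lemma enorm_ge_coord (R : realType) d (n : 'rV[int]_d) i :
  (`|n 0 i|)%:~R <= enorm n :> R.
Proof.
rewrite -(@ler_pXn2r _ 2) ?nnegrE ?sqrtr_ge0 ?ler0z// enorm_sqr (bigD1 i)//=.
rewrite -rmorphXn/= real_normK ?num_real// rmorphXn/= lerDl.
by apply: sumr_ge0 => j _; exact: sqr_ge0.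
Qed.

Lemma comparable_to_power_small (R : realType) d (a : 'rV[int]_d -> R) (alpha eps : R) :
  0 < alpha -> comparable_to_power a alpha -> 0 < eps ->
  exists L : nat, forall n, ~ box L n -> a n <= eps.
Proof.
move=> alpha0 [c1 [c2 [c10 c12 aP]]] eps0.
have c20 : 0 < c2 by exact: lt_le_trans c12.
pose K := (c2 / eps) `^ alpha^-1.
have K0 : 0 <= K by exact: powR_ge0.
exists (Num.bound K) => n nL.
have [i ni] : exists i, (Num.bound K)%:Z < `|n ord0 i|.
  by apply/not_existsP => h; apply: nL => i; rewrite leNgt; apply/negP.
have n0 : n != 0.
  by apply/eqP => n0; move: ni; rewrite n0 mxE normr0 ltNge le0z_nat.
have Kn : K <= enorm n.
  apply: le_trans (enorm_ge_coord R n i); apply: le_trans (ltW (archi_boundP K0)) _.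
  by rewrite -[leLHS]/((Num.bound K)%:Z%:~R) ler_int ltW.
have /andP[_ /le_trans] := aP n n0; apply.
have cn : c2 / eps <= enorm n `^ alpha.
  have ce0 : 0 <= c2 / eps by rewrite divr_ge0 ?ltW.
  rewrite -[leLHS]powRr1// -(mulVf (lt0r_neq0 alpha0)) powRrM -/K.
  by apply: (ge0_ler_powR (ltW alpha0)); rewrite ?nnegrE // sqrtr_ge0.
have n1 : 0 < enorm n `^ alpha by apply: lt_le_trans cn; exact: divr_gt0.
by rewrite powRN ler_pdivrMr// mulrC -ler_pdivrMr.
Qed.

(** * Expectations and passage to the limit *)

Lemma le_expectation (R : realType) d (T : measurableType d) (P : probability T R)
    (f g : T -> R) : (forall x, 0 <= f x) -> (forall x, f x <= g x) ->
  ('E_P[f] <= 'E_P[g])%E.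
Proof.
move=> f0 fg; rewrite unlock.
by apply: le_integral_nonmeasurable => x; rewrite lee_fin.
Qed.

Lemma expectation_sum_indic (R : realType) d (T : measurableType d)
    (P : probability T R) (I : Type) (s : seq I) (G : I -> set T) :
  (forall i, measurable (G i)) ->
  ('E_P[fun w => (\sum_(i <- s) \1_(G i) w)%R] = \sum_(i <- s) P (G i))%E.
Proof.
move=> mG; rewrite unlock.
under eq_integral do rewrite -sumEFin.
rewrite ge0_integral_sum//.
- by apply: eq_bigr => i _; rewrite integral_indic// setIT.
- by move=> i; apply/measurable_EFinP; exact: measurable_indic.
Qed.

Theorem corollary1p5 (R : realType) (d : nat) (hd : (1 <= d)%N)
    (dT : measure_display) (T : measurableType dT) (P : probability T R)
    (delta alpha : R) (hdelta : 1 < delta) (halpha : 0 < alpha)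
    (hdecay : 0 < d%:R - alpha * (delta - 1))
    (q : 'rV[int]_d -> {RV P >-> R})
    (q_indep : mutually_independent q)
    (q_law : forall n, has_density (q n) (pareto_density delta))
    (a : 'rV[int]_d -> R) (a_pos : forall n, 0 < a n)
    (a_decay : comparable_to_power a alpha)
    (M1 M2 : R) (hM1 : M1 < - (2 * d%:R)) (hM2 : 2 * d%:R < M2) :
  (fun L : nat =>
     ((((2 * L + 1) ^ d)%:R : R)^-1)%:E *
     'E_P[(fun omega : T =>
             (eigenvalue_count
                (box_matrix (schrodinger (fun n => a n * q n omega)) L)
                `]M1, M2[%classic)%:R)%R])%E
    @ \oo --> 1%E.
Proof.
pose eps : R := Num.min (M2 - 2 * d%:R) (- (2 * d%:R) - M1).
have eps0 : 0 < eps by rewrite lt_min; apply/andP; split; lra.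
have epsM1 : eps <= - (2 * d%:R) - M1 by rewrite ge_min lexx orbT.
have epsM2 : eps <= M2 - 2 * d%:R by rewrite ge_min lexx.
pose G n : set T := [set w | `|a n * q n w| < eps].
have mball (t : R) : measurable [set x : R | `|x| < t].
  rewrite (_ : [set x | _] = `](- t), t[%classic)//.
  by apply/seteqP; split => x; rewrite /= in_itv/= ltr_norml.
have mq n (t : R) : measurable (q n @^-1` [set x | `|x| < t]).
  by rewrite -[X in measurable X]setTI; exact: measurable_funP.
have GE n : G n = q n @^-1` [set x | `|x| < eps / a n].
  apply/seteqP; split => w; rewrite /G/= normrM (gtr0_norm (a_pos n));
  by rewrite ltr_pdivlMr// mulrC.
have mG n : measurable (G n).
  by rewrite GE; exact: mq.
pose N L : nat := ((2 * L + 1) ^ d)%N.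
(* Since d >= 1 the volume tends to infinity, so any fixed box becomes negligible. *)
have LN L : (L <= N L)%N.
  have : (2 * L + 1 <= N L)%N by rewrite -{1}[(2 * L + 1)%N]expn1 leq_pexp2l ?addn1.
  by apply: leq_trans; rewrite mul2n -addnn -addnA leq_addr.
pose c L w : nat := eigenvalue_count
  (box_matrix (schrodinger (fun n => a n * q n w)) L) `]M1, M2[%classic.
have cN L w : (c L w <= N L)%N by rewrite /N -card_box eigenvalue_count_leq.
have cG L w : \sum_(n <- fset_set (@box d L)) \1_(G n) w <= (c L w)%:R :> R.
  rewrite [leLHS](_ : _ = (count (fun n => `|a n * q n w| < eps)
      (fset_set (@box d L)))%:R); last first.
    rewrite -sum1_count natr_sum [RHS]big_mkcond/=; apply: eq_bigr => n _.
    rewrite indicE; case: ifPn => h; first by rewrite mem_set.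
    by rewrite memNset//; exact/negP.
  rewrite ler_nat; apply: leq_trans (count_small_potential _ _ hd eps0) _.
  apply: eigenvalue_countS; first exact: trmx_box_matrix.
  by move=> x /=; rewrite !in_itv/= => /andP[x1 x2]; apply/andP; split; lra.
pose E L := ('E_P[fun w => (c L w)%:R])%E.
(* The count never exceeds the matrix size: this bounds the ratio by 1 and makes [E L] finite. *)
have EN L : (E L <= (N L)%:R%:E)%E.
  rewrite -(expectation_cst P (N L)%:R); apply: le_expectation => // w.
  by rewrite ler_nat.
have E0 L : (0 <= E L)%E by apply: expectation_ge0.
have Efin L : E L \is a fin_num.
  by rewrite ge0_fin_numE//; apply: le_lt_trans (EN L) _; rewrite ltry.
have EG L : (\sum_(n <- fset_set (@box d L)) P (G n) <= E L)%E.
  rewrite -expectation_sum_indic//; apply: le_expectation => // w.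
  by apply: sumr_ge0.
have N0 L : 0 < (N L)%:R :> R by rewrite ltr0n expn_gt0 addn1.
apply: cvg_EFin; first by apply: nearW => L; rewrite fin_numM//; exact: Efin.
rewrite (_ : _ \o _ = fun L => (N L)%:R^-1 * fine (E L)); last first.
  by apply/funext => L /=; rewrite fineM//; exact: Efin.
apply/cvgrPdist_le => e e0.
have e20 : 0 < e / 2 by rewrite divr_gt0.
(* The radius [t], chosen for [q 0], serves every site because the laws coincide. Outside [box L0]
   one has [a n <= eps / t], so [|q n| < t] forces [|a n * q n| < eps]. *)
have [t t0 tP] := @distribution_ball_near1 _ _ _ P (q 0) _ e20.
have [L0 L0P] := comparable_to_power_small halpha a_decay (divr_gt0 eps0 t0).
have PG n : ~ box L0 n -> ((1 - e / 2)%:E <= P (G n))%E.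
  move=> /L0P an; apply: le_trans tP _.
  have -> : distribution P (q 0) [set x | `|x| < t] =
            distribution P (q n) [set x | `|x| < t] by rewrite !q_law.
  rewrite GE -[leLHS]/(P (q n @^-1` [set x | `|x| < t])).
  apply: le_measure; rewrite ?inE.
  - exact: mq.
  - exact: mq.
  - move=> w /= /lt_le_trans; apply.
    by rewrite ler_pdivlMr// mulrC -ler_pdivlMr.
near=> L.
(* Holds as soon as [L] exceeds [N L0] divided by [e / 2]. *)
have NL : (N L0)%:R <= e / 2 * (N L)%:R.
  rewrite -ler_pdivrMl//; apply: (@le_trans _ _ L%:R); first by near: L; exact: nbhs_infty_ger.
  by rewrite ler_nat.
have lower : (1 - e / 2) * (N L)%:R - (N L0)%:R <= fine (E L).
  rewrite -lee_fin fineK//; apply: le_trans (EG L).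
  (* Subtracting the indicator of [box L0] makes the bound valid at every site: inside, it is
     [- (e / 2)], below any probability. *)
  apply: (@le_trans _ _ (\sum_(n <- fset_set (@box d L))
    ((1 - e / 2) - (n \in box L0)%:R)%:E)%E); last first.
    apply: lee_sum => n _; case: (boolP (n \in _)) => [_|/negP nL0].
      by apply: (@le_trans _ _ 0%E) => //; rewrite lee_fin/=; lra.
    by rewrite subr0; apply: PG => /mem_set.
  rewrite sumEFin lee_fin sumrB lerB//.
    rewrite big_const_seq count_predT iter_addr_0 -[leRHS]mulr_natr.
    by rewrite [size _]card_box.
  rewrite -natr_sum ler_nat /N -card_box.
  rewrite (_ : \sum_(n <- _) _ = size [seq n <- fset_set (@box d L) | n \in box L0])%N.
    apply: uniq_leq_size; first by rewrite filter_uniq// fset_uniq.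
    by move=> n; rewrite mem_filter => /andP[n0 _]; rewrite in_fset_set//; exact: finite_box.
  by rewrite size_filter -sum1_count [RHS]big_mkcond.
rewrite ger0_norm ?subr_ge0; last first.
  by rewrite ler_pdivrMl// mulr1 -lee_fin fineK.
(* One [e / 2] is lost in [lower] to the probabilities and the other, through [NL], to the inner
   box. *)
rewrite lerBlDr -lerBlDl ler_pdivlMl//.
by lra.
Unshelve. all: end_near.
Qed.
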